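(* For any $n\ge 2$, $$K_n(d,r)=\frac{d^{\binom{n-1}{2}-1}}{r}\,L_n\!\left(\frac1d,\,rd\right),$$ where $K_n(d,r)=\sum_f d^{\deg(f)}r^{\rho(f)}$, the (formal) sum being over all parking configurations $f$ of $K_n$ with $f_1\le f_2\le\cdots\le f_{n-1}$, and $L_n(x,y)=\sum_{w\in D_n}\sum_{s=-\infty}^{+\infty}x^{\mathrm{left}(w,s)}y^{\mathrm{right}(w,s)}$.
   Context: A configuration on the complete graph $K_n$ (vertices $x_1,\ldots,x_n$) is an element $f\in\mathbb{Z}^n$ and $\deg(f)=\sum_i f_i$. Let $\varepsilon^{(i)}$ be the $i$-th standard basis vector, $\Delta^{(i)}=(n-1)\varepsilon^{(i)}-\sum_{j\ne i}\varepsilon^{(j)}$, and $L_G$ the subgroup generated by the $\Delta^{(i)}$. Two configurations are toppling equivalent if their difference is in $L_G$. A configuration is effective if all entries are $\ge0$, and $L_G$-effective if toppling equivalent to an effective one. Rank: $\rho(f)=-1$ if $f$ is not $L_G$-effective; otherwise $\rho(f)$ is the largest integer $r$ such that $f-\lambda$ is $L_G$-effective for every effective $\lambda$ of degree $r$. A configuration $f$ is a parking configuration if $f_i\ge0$ for all $i<n$ and for every non-empty $Y\subseteq\{1,\ldots,n-1\}$ there is $k\in Y$ with $f_k<n-|Y|$ (no condition on $f_n$). Words are over $\{a,b\}$; $\delta(u)=|u|_a-|u|_b$. $D_n$ is the set of words with $n-1$ letters $a$ and $n$ letters $b$ such that $\delta(u)\ge 0$ for every strict prefix $u$. Labelled strip: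 the strip $0\le y\le n-1$ is cut into $n-1$ infinite rows of unit cells; the cell $[x-1,x]\times[y,y+1]$ ($x\in\mathbb{Z}$, $0\le y\le n-2$) has label $ny-(n-1)x$. A word $w\in D_n$ is drawn as a lattice path starting at the origin, north step for $a$, east step for $b$. In each row, the cells to the west of the unique north step in that row form the left region, those to the east the right region. For $s\in\mathbb{Z}$, $\mathrm{left}(w,s)$ is the number of left-region cells with label $\le s$ and $\mathrm{right}(w,s)$ is the number of right-region cells with label $>s$. The identity is one of formal sums of monomials in $d,d^{-1},r,r^{-1}$. *)

(* Defs.v *)
From mathcomp Require Import all_boot all_order all_algebra finmap.
From mathcomp Require Import all_classical zify.
Set Implicit Arguments.
Unset Strict Implicit.
Unset Printing Implicit Defensive.
Import Order.TTheory GRing.Theory Num.Theory.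
Local Open Scope classical_set_scope.
Local Open Scope ring_scope.

(* The vertex x_i of K_n is the ordinal of value i - 1; the sink x_n is thus
   the ordinal of value n.-1. *)
Notation config n := {ffun 'I_n -> int}.

Definition deg n (f : config n) : int := \sum_i f i.

Definition laplacian n (i : 'I_n) : config n :=
  [ffun j => if j == i then n%:Z - 1 else -1].

(* The subgroup generated by the laplacian vectors. *)
Definition toppling_lattice n : set (config n) :=
  [set f | exists c : 'I_n -> int, f = \sum_i laplacian i *~ c i].

Definition toppling_equiv n (f g : config n) : Prop :=
  toppling_lattice (f - g).

Definition effective n (f : config n) : Prop := forall i, 0 <= f i.

Definition Leffective n (f : config n) : Prop :=
  exists2 g, effective g & toppling_equiv f g.

Definition rank_candidates n (f : config n) : set int :=
  [set r | forall lam : config n, effective lam -> deg lam = r ->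
           Leffective (f - lam)].

(* [A `&` ubound A] is the set of the largest elements of A; for an
   L-effective f on a nonempty graph it is a singleton, see [rankP]. *)
Definition rank n (f : config n) : int :=
  if `[< Leffective f >]
  then xget (-1) (rank_candidates f `&` ubound (rank_candidates f))
  else -1.

Lemma deg_toppling n (f : config n) : toppling_lattice f -> deg f = 0.
Proof.
case=> c ->; rewrite /deg.
under eq_bigr => j _ do rewrite sum_ffunE.
rewrite exchange_big big1 //= => i _.
have hE j : (laplacian i *~ c i) j = laplacian i j *~ c i.
  have h k : (laplacian i *+ k) j = laplacian i j *+ k.
    elim: k => [|k IH]; first by rewrite !mulr0n ffunE.
    by rewrite !mulrS ffunE IH.
  case: (c i) => k; first by rewrite -!pmulrn h.
  by rewrite NegzE !mulrNz -!pmulrn ffunE h.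
under eq_bigr => j _ do rewrite hE.
rewrite -mulrz_suml (bigD1 i) //= ffunE eqxx.
under eq_bigr => j /negPf hj do rewrite ffunE hj.
rewrite sumr_const cardC1 card_ord.
suff -> : n%:Z - 1 + -1 *+ n.-1 = 0 by rewrite mul0rz.
by case: n {f c hE} i => [[]//|n] _; rewrite mulNrn natz /=; lia.
Qed.

Lemma rankP n (f : config n) : (0 < n)%N -> Leffective f ->
  rank_candidates f (rank f) /\
  (forall r, rank_candidates f r -> r <= rank f).
Proof.
move=> n0 hf; rewrite /rank asboolT //.
suff [x xP] : exists x, (rank_candidates f `&` ubound (rank_candidates f)) x.
  by have [] := xgetPex (-1 : int) (ex_intro _ x xP).
have degB (g h : config n) : deg (g - h) = deg g - deg h.
  rewrite /deg; under eq_bigr => j _ do rewrite !ffunE.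
  by rewrite sumrB.
have bnd (r : nat) : rank_candidates f r%:Z -> r%:Z <= deg f.
  move=> hr; pose lam : config n := [ffun j => r%:Z *+ (j == Ordinal n0)].
  have dlam : deg lam = r%:Z.
    rewrite /deg (bigD1 (Ordinal n0)) //= ffunE eqxx big1 ?addr0 //.
    by move=> j /negPf hj; rewrite ffunE hj.
  have [|g hg /deg_toppling] := hr lam _ dlam.
    by move=> j; rewrite ffunE; case: (_ == _).
  rewrite !degB dlam => /eqP; rewrite subr_eq0 => /eqP hd.
  by rewrite -subr_ge0 hd sumr_ge0.
have h0 : rank_candidates f 0.
  move=> lam hl dl; suff -> : lam = 0 by rewrite subr0.
  apply/ffunP => j; rewrite ffunE.
  by have /psumr_eq0P := dl; apply.
pose P : pred nat := fun k => `[< rank_candidates f k%:Z >].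
have exP : exists k, P k by exists 0%N; apply/asboolP.
have ubP k : P k -> (k <= `|deg f|)%N.
  move/asboolP/bnd => h; rewrite -lez_nat abszE (le_trans h) //; exact: ler_norm.
case: (ex_maxnP exP ubP) => k /asboolP kP kmax.
exists k%:Z; split => // -[r|r] hr //.
by rewrite lez_nat kmax //; apply/asboolP.
Qed.

Definition parking n (f : config n) : Prop :=
  (forall i : 'I_n, (i < n.-1)%N -> 0 <= f i) /\
  (forall Y : {set 'I_n}, Y != finset.set0 ->
     (forall i, i \in Y -> (i < n.-1)%N) ->
     exists2 k, k \in Y & f k < n%:Z - #|Y|%:Z).

Definition sorted_off_sink n (f : config n) : Prop :=
  forall i j : 'I_n, (i <= j)%N -> (j < n.-1)%N -> f i <= f j.

(* The letter a is [true], the letter b is [false]. *)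
Definition word := seq bool.

Definition nba (u : word) : nat := count_mem true u.
Definition nbb (u : word) : nat := count_mem false u.

Definition delta (u : word) : int := (nba u)%:Z - (nbb u)%:Z.

Definition Dwords (n : nat) : set word :=
  [set w | [/\ nba w = n.-1, nbb w = n &
            forall u, prefix u w -> u != w -> 0 <= delta u]].

(* The pair (x, y) stands for the cell [x-1, x] * [y, y+1]. *)
Notation cell n := (int * 'I_n.-1)%type.

Definition label n (c : cell n) : int :=
  n%:Z * (c.2 : nat)%:Z - (n%:Z - 1) * c.1.

(* The path of w has a north step from (x, y) to (x, y + 1). *)
Definition north_step (w : word) (x y : nat) : Prop :=
  exists u : word, [/\ prefix (rcons u true) w, nbb u = x & nba u = y].

(* The cell [c.1 - 1, c.1] lies west of the abscissa x iff c.1 <= x, and east of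
   it iff x <= c.1 - 1. *)
Definition left_region n (w : word) : set (cell n) :=
  [set c : cell n | exists2 x, north_step w x c.2 & c.1 <= x%:Z].

Definition right_region n (w : word) : set (cell n) :=
  [set c : cell n | exists2 x, north_step w x c.2 & x%:Z < c.1].

Definition left_cells n (w : word) (s : int) : set (cell n) :=
  [set c : cell n | left_region w c /\ label c <= s].

Definition right_cells n (w : word) (s : int) : set (cell n) :=
  [set c : cell n | right_region w c /\ s < label c].

Lemma finite_cells n (B : nat) : finite_set [set c : cell n | `|c.1| <= B%:Z].
Proof.
have hI : finite_set [set x : int | `|x| <= B%:Z].
  apply: (@sub_finite_set _ _
    ((fun k : nat => k%:Z - B%:Z) @` `I_(B + B).+1)); last first.
    by apply: finite_image; exact: finite_II.
  move=> x /= hx; by exists (absz (x + B%:Z)) => /=; lia.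
apply: (@sub_finite_set _ _ ([set x : int | `|x| <= B%:Z] `*` setT)).
  by move=> c /= hc; split.
by apply: finite_setX => //; exact: finite_finset.
Qed.

Lemma north_step_bound w x y : north_step w x y -> (x <= size w)%N.
Proof.
case=> u [/prefixP[v ->] <- _]; rewrite size_cat size_rcons.
by rewrite (leq_trans (count_size _ _)) // addSn ltnW // ltnS leq_addr.
Qed.

Lemma finite_left_cells n w s : (2 <= n)%N -> finite_set (@left_cells n w s).
Proof.
move=> hn; apply: (sub_finite_set _ (@finite_cells n (size w + absz s))).
move=> [x y] [[z /north_step_bound hz /= hx]]; rewrite /label /= => hl.
by case: y hl => y hy /= hl; nia.
Qed.

Lemma finite_right_cells n w s : (2 <= n)%N -> finite_set (@right_cells n w s).
Proof.
move=> hn; apply: (sub_finite_set _ (@finite_cells n (n * n + absz s))).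
move=> [x y] [[z _ /= hx]]; rewrite /label /= => hl.
by case: y hl => y hy /= hl; nia.
Qed.

(* Cardinality in nat: meaningful as these sets of cells are finite for
   n >= 2, see [finite_left_cells] and [finite_right_cells]. *)
Definition left_count n (w : word) (s : int) : nat :=
  #|` fset_set (@left_cells n w s)|%fset.

Definition right_count n (w : word) (s : int) : nat :=
  #|` fset_set (@right_cells n w s)|%fset.

(* The monomial u^p v^q is represented by (p, q), and a formal sum of monomials
   by its coefficients.  Multiplying monomials is adding exponents. *)
Notation monomial := (int * int)%type.

Definition laurent : Type := monomial -> int.

Definition fiber (I : choiceType) (A : set I) (e : I -> monomial)
    (m : monomial) : set I := [set i | A i /\ e i = m].

(* The formal sum of the monomials e i, for i in A, makes sense if each monomial
   occurs finitely often. *)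
Definition summable (I : choiceType) (A : set I) (e : I -> monomial) : Prop :=
  forall m, finite_set (fiber A e m).

Definition formal_sum (I : choiceType) (A : set I) (e : I -> monomial)
    : laurent := fun m => (#|` fset_set (fiber A e m)|%fset)%:Z.

(* F(mu, mv), for monomials mu and mv.  The sum is one of finite support, equal
   to 0 otherwise; this does not occur when (mu, mv) are independent, since the
   sum then has at most one term, see [monomial_substE]. *)
Definition monomial_subst (F : laurent) (mu mv : monomial) : laurent :=
  fun m => \sum_(p \in [set p : monomial | mu *~ p.1 + mv *~ p.2 = m]) F p.

Lemma monomial_substE F (m : monomial) :
  monomial_subst F (-1, 0) (1, 1) m = F (m.2 - m.1, m.2).
Proof.
rewrite /monomial_subst.
have hz (a b : int) (k : int) : ((a, b) : monomial) *~ k = (a * k, b * k).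
  have h (i : nat) : ((a, b) : monomial) *+ i = (a * i%:Z, b * i%:Z).
    elim: i => [|i IH]; first by rewrite !mulr0.
    by rewrite mulrS IH; congr pair => /=; lia.
  case: k => i; first by rewrite -pmulrn h.
  by rewrite NegzE mulrNz -pmulrn h; congr pair => /=; lia.
suff -> : [set p : monomial | ((-1, 0) : monomial) *~ p.1 +
    ((1, 1) : monomial) *~ p.2 = m] = [set (m.2 - m.1, m.2)].
  by rewrite fsbig_set1.
apply/seteqP; split => -[p q] /=; rewrite !hz.
  by case: m => x y [/= hx hy]; congr pair; lia.
by case: m => x y [-> ->]; congr pair => /=; lia.
Qed.

Definition monomial_mul (c : monomial) (F : laurent) : laurent :=
  fun m => F (m - c).

Definition K_index n : set (config n) :=
  [set f | parking f /\ sorted_off_sink f].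

(* exponents of (d, r) *)
Definition K_term n (f : config n) : monomial := (deg f, rank f).

Definition K_series n : laurent := formal_sum (@K_index n) (@K_term n).

Definition L_index n : set (word * int) := [set ws | Dwords n ws.1].

(* exponents of (x, y) *)
Definition L_term n (ws : word * int) : monomial :=
  ((left_count n ws.1 ws.2)%:Z, (right_count n ws.1 ws.2)%:Z).

Definition L_series n : laurent := formal_sum (L_index n) (L_term n).

(* Main.v *)
Require Import Defs.
From mathcomp Require Import all_boot all_order all_algebra finmap fingroup perm.
From mathcomp Require Import all_classical zify ring.
Set Implicit Arguments.
Unset Strict Implicit.
Unset Printing Implicit Defensive.
Import Order.TTheory GRing.Theory Num.Theory.
Local Open Scope ring_scope.

(* Write n = N + 1.  Let M be the set of the vectors equivalent to a permutation
   of (0, ..., n - 1); M - 1 consists of the maximal non-effective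
   configurations, and rank f + 1 is the minimum over m in M of the sum of the
   positive parts of f_i + 1 - m_i.  As M is stable under m |-> N - m, this
   formula gives the Riemann-Roch theorem for the canonical configuration
   (n - 3, ..., n - 3).

   For a sorted parking configuration f, the minimum is attained at an explicit
   m with m_n = f_n + 1, and the summand of index i is then the number of
   cells of label <= f_n on the left of the path in row i - 1, where the path is
   the one having its i-th north step at abscissa f_i.  Minimality of m holds
   because the resulting value phi f vanishes when f is not effective and
   decreases by at most 1 when f is replaced with the sorted parking
   representative of f minus a basis vector.  Hence
   left = rank f + 1 and right = left - deg f + C(N, 2) - 1.  Composing this
   bijection between configurations and pairs (w, s) with the Riemann-Roch
   duality, f being sent to the sorted parking representative of
   (n - 3, ..., n - 3) - f, turns these two numbers into
   rank f - deg f + C(N, 2) and rank f + 1. *)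

(** * Maximal non-effective configurations *)

Definition pos (x : int) : int := Num.max 0 x.

(** [pos] is nondecreasing and 1-Lipschitz, and only the summand [i0] may grow; [i0] may also lie
    outside [P]. *)
Lemma sum_pos_step (I : finType) (P : pred I) (i0 : I) (t u : I -> int) :
  (forall i, P i -> t i <= u i + (i == i0)%:Z) ->
  \sum_(i | P i) pos (t i) <= \sum_(i | P i) pos (u i) + 1.
Proof.
move=> tu; have [Pi0|Pi0] := boolP (P i0); last first.
  apply: (@le_trans _ _ (\sum_(i | P i) pos (u i))); last by rewrite lerDl.
  apply: ler_sum => i Pi; have := tu i Pi.
  have -> : (i == i0) = false by apply: contraNF Pi0 => /eqP <-.
  by rewrite /pos /=; lia.
rewrite (bigD1 i0) //= [in leRHS](bigD1 i0) //= addrAC.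
apply: lerD; first by have := tu i0 Pi0; rewrite eqxx /pos; lia.
apply: ler_sum => i /andP[Pi /negPf ii0].
by have := tu i Pi; rewrite ii0 /pos; lia.
Qed.

Lemma sum_pos_opp (I : finType) (t : I -> int) :
  \sum_i pos (- t i) = \sum_i pos (t i) - \sum_i t i.
Proof. by rewrite -sumrB; apply: eq_bigr => i _; rewrite /pos; lia. Qed.

Lemma mulrz_ffunE (I : finType) (f : {ffun I -> int}) (k : int) i :
  (f *~ k) i = f i * k.
Proof.
have h m : (f *+ m) i = f i * m%:Z.
  elim: m => [|m IH]; first by rewrite mulr0n ffunE mulr0.
  by rewrite mulrS ffunE IH intS mulrDr mulr1.
case: k => m; first by rewrite -pmulrn h.
by rewrite NegzE mulrNz -pmulrn ffunE h mulrN.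
Qed.

Lemma sum_perm (I : finType) (s : {perm I}) (F : I -> int) :
  \sum_i F (s i) = \sum_i F i.
Proof. by rewrite [RHS](reindex_perm s). Qed.

(** Coordinate [i] of the combination of the laplacian vectors with coefficients [c], in the closed
    form available on a complete graph. *)
Definition topple N (c : 'I_N.+1 -> int) (i : 'I_N.+1) : int :=
  N.+1%:Z * c i - \sum_j c j.

Lemma topple0 N (i : 'I_N.+1) : topple (fun=> 0) i = 0.
Proof. by rewrite /topple big1 // mulr0 subr0. Qed.

Lemma toppleD N (c d : 'I_N.+1 -> int) i :
  topple (fun j => c j + d j) i = topple c i + topple d i.
Proof. by rewrite /topple big_split /= mulrDr opprD addrACA. Qed.

Lemma toppleN N (c : 'I_N.+1 -> int) i : topple (fun j => - c j) i = - topple c i.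
Proof. by rewrite /topple sumrN mulrN opprB opprK addrC. Qed.

Lemma topple_perm N (s : {perm 'I_N.+1}) (c : 'I_N.+1 -> int) i :
  topple (fun j => c (s j)) i = topple c (s i).
Proof. by rewrite /topple (sum_perm s c). Qed.

Lemma sum_topple N (c : 'I_N.+1 -> int) : \sum_i topple c i = 0.
Proof.
rewrite /topple big_split /= -mulr_sumr sumr_const card_ord.
by rewrite -mulr_natl natz mulrN subrr.
Qed.

Lemma toppling_equivP N (f g : config N.+1) :
  toppling_equiv f g <->
  exists c : 'I_N.+1 -> int, forall i, f i = g i + topple c i.
Proof.
have E (c : 'I_N.+1 -> int) : \sum_j laplacian j *~ c j = [ffun i => topple c i].
  apply/ffunP => i; rewrite ffunE /topple.
  rewrite sum_ffunE (bigD1 i) //= (bigD1 i (F := c)) //= mulrz_ffunE ffunE eqxx.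
  suff -> : \sum_(j | j != i) (laplacian j *~ c j) i = - \sum_(j | j != i) c j.
    by ring.
  rewrite -sumrN; apply: eq_bigr => j ji.
  by rewrite mulrz_ffunE ffunE eq_sym (negPf ji) mulN1r.
split=> -[c hc]; exists c.
  move=> i; rewrite [f](_ : _ = g + [ffun i => topple c i]) ?ffunE //.
  by rewrite -E -hc addrC subrK.
by rewrite E; apply/ffunP => i; rewrite !ffunE hc addrC addKr.
Qed.

(* Each class contains exactly one sorted parking configuration: see
   [exists_parking_rep] and [perm_equiv_K_index]. *)
Definition perm_equiv N (f g : config N.+1) : Prop :=
  exists (s : {perm 'I_N.+1}) (c : 'I_N.+1 -> int), s ord_max = ord_max /\
    forall i, g (s i) = f i + topple c i.

Lemma perm_equiv_perm N (s : {perm 'I_N.+1}) (f g : config N.+1) :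
  s ord_max = ord_max -> (forall i, g (s i) = f i) -> perm_equiv f g.
Proof.
by move=> sm fg; exists s, (fun=> 0); split=> // i; rewrite fg topple0 addr0.
Qed.

Lemma perm_equiv_refl N (f : config N.+1) : perm_equiv f f.
Proof. by apply: (@perm_equiv_perm _ 1%g) => [|i]; rewrite perm1. Qed.

Lemma perm_equiv_toppling N (f g : config N.+1) : toppling_equiv g f -> perm_equiv f g.
Proof.
by case/toppling_equivP => c fg; exists 1%g, c; split=> [|i]; rewrite perm1.
Qed.

Lemma perm_equiv_sym N (f g : config N.+1) : perm_equiv f g -> perm_equiv g f.
Proof.
move=> [s [c [sm fg]]]; exists s^-1%g, (fun i => - c (s^-1%g i)); split.
  by rewrite -{1}sm permK.
by move=> i; rewrite toppleN (topple_perm s^-1%g c) -{2}[i](permKV s) fg addrK.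
Qed.

Lemma perm_equiv_trans N (g f h : config N.+1) :
  perm_equiv f g -> perm_equiv g h -> perm_equiv f h.
Proof.
move=> [s [c [sm fg]]] [t [d [tm gh]]].
exists (s * t)%g, (fun i => c i + d (s i)); split; first by rewrite permM sm.
by move=> i; rewrite permM gh fg toppleD (topple_perm s d) -addrA.
Qed.

Definition unit_config N (j : 'I_N.+1) : config N.+1 := [ffun i => (i == j)%:Z].

Lemma perm_equiv_sub_unit N (f g : config N.+1) j : perm_equiv f g ->
  exists j', perm_equiv (f - unit_config j) (g - unit_config j').
Proof.
move=> [s [c [sm fg]]]; exists (s j), s, c; split=> // i.
by rewrite !ffunE (inj_eq perm_inj) fg addrAC.
Qed.

Lemma perm_equiv_deg N (f g : config N.+1) : perm_equiv f g -> deg f = deg g.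
Proof.
move=> [s [c [_ fg]]]; rewrite /deg [RHS](reindex_perm s).
under [RHS]eq_bigr => i _ do rewrite fg.
by rewrite big_split /= sum_topple addr0.
Qed.

(* Here m is a maximal non-effective configuration plus (1, ..., 1): this shift
   turns the permutations of (-1, 0, ..., n - 2) into those of (0, ..., n - 1). *)
Definition maxnoneff N (m : 'I_N.+1 -> int) : Prop :=
  exists (s : {perm 'I_N.+1}) (c : 'I_N.+1 -> int),
    forall i, m i = (s i : nat)%:Z + topple c i.

(** The minimum over [m] is handled through its upper bounds [k]. For [k = 0] this says that [f]
    lies below some [m - 1] in every coordinate. *)
Definition noneff_within N (f : config N.+1) (k : int) : Prop :=
  exists2 m, maxnoneff m & \sum_i pos (f i + 1 - m i) <= k.

Lemma maxnoneff_perm_equiv N (s : {perm 'I_N.+1}) (c m m' : 'I_N.+1 -> int) :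
  (forall i, m' (s i) = m i + topple c i) -> maxnoneff m -> maxnoneff m'.
Proof.
move=> mm' [t [d md]].
exists (s^-1 * t)%g, (fun i => d (s^-1%g i) + c (s^-1%g i)) => i.
have -> : m' i = m (s^-1%g i) + topple c (s^-1%g i) by rewrite -mm' permKV.
by rewrite toppleD (topple_perm s^-1%g d) (topple_perm s^-1%g c) permM md -addrA.
Qed.

Lemma perm_equiv_noneff N (f g : config N.+1) k :
  perm_equiv f g -> noneff_within f k -> noneff_within g k.
Proof.
move=> [s [c [_ fg]]] [m mM mk].
pose m' i := m (s^-1%g i) + topple c (s^-1%g i).
exists m'; first by apply: (maxnoneff_perm_equiv (s := s) _ mM) => i; rewrite /m' permK.
rewrite (reindex_perm s) (le_trans _ mk) // ler_sum // => i _.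
by rewrite fg /m' permK /pos; lia.
Qed.

(** Take [k] with [(c k, s k)] lexicographically least. Then [c j >= c k], strictly if [s j < s k],
    which happens for [s k] indices [j]; summing over [j] gives [m k <= 0]. *)
Lemma maxnoneff_le0 N (m : 'I_N.+1 -> int) : maxnoneff m -> exists i, m i <= 0.
Proof.
move=> [s [c mE]]; pose v i := N.+1%:Z * c i + (s i : nat)%:Z.
case: (@arg_minP _ _ 'I_N.+1 ord0 xpredT v isT) => k _ kmin; exists k.
have ck j : c k + ((s j < s k)%N)%:Z <= c j.
  have := kmin j isT; rewrite /v; have := ltn_ord (s j); have := ltn_ord (s k).
  by case: (ltnP (s j) (s k)) => /=; nia.
have : \sum_j (c k + ((s j < s k)%N)%:Z) <= \sum_j c j by apply: ler_sum.
rewrite big_split /= sumr_const card_ord -mulr_natl natz.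
rewrite (sum_perm s (fun j : 'I_N.+1 => ((j < s k)%N)%:Z)).
suff -> : \sum_(j < N.+1) ((j < s k)%N)%:Z = (s k : nat)%:Z.
  by rewrite mE /topple; move: (\sum_j c j) => S; lia.
rewrite -(big_morph Posz PoszD (erefl _)) -big_mkcond /=.
by rewrite -(big_ord_widen _ (fun=> 1%N)) ?sum1_card ?card_ord // ltnW.
Qed.

Lemma maxnoneff_rev N (m : 'I_N.+1 -> int) :
  maxnoneff m -> maxnoneff (fun i => N%:Z - m i).
Proof.
move=> [s [c mE]].
exists (s * perm rev_ord_inj)%g, (fun i => - c i) => i.
rewrite toppleN mE permM permE /=.
by have := ltn_ord (s i); set S := topple c i; lia.
Qed.

Lemma maxnoneff_sum N (m : 'I_N.+1 -> int) :
  maxnoneff m -> \sum_i m i = 'C(N.+1, 2)%:Z.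
Proof.
move=> [s [c mE]]; under eq_bigr do rewrite mE.
rewrite big_split /= sum_topple addr0.
rewrite (sum_perm s (fun i : 'I_N.+1 => (i : nat)%:Z)).
by rewrite -(big_morph Posz PoszD (erefl _)) -bin2_sum big_mkord.
Qed.

(** The canonical divisor of the graph: every vertex has degree [N], and its entry is this degree
    minus 2. *)
Definition canonical_config N : config N.+1 := [ffun=> N%:Z - 2].

(** Replacing [m] with [N - m] turns each [f i + 1 - m i] into its opposite. Positive and negative
    parts differ by the sum of these terms, which is the same for all [m] in M. *)
Lemma noneff_within_dual N (f : config N.+1) k : noneff_within f k ->
  noneff_within (canonical_config N - f) (k - deg f + 'C(N, 2)%:Z - 1).
Proof.
move=> [m mM mk]; exists (fun i => N%:Z - m i); first exact: maxnoneff_rev.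
have -> : \sum_i pos ((canonical_config N - f) i + 1 - (N%:Z - m i)) =
    \sum_i pos (- (f i + 1 - m i)).
  by apply: eq_bigr => i _; rewrite !ffunE; congr pos; ring.
have := maxnoneff_sum mM; rewrite sum_pos_opp sumrB [X in _ - (X - _)]big_split /=.
rewrite sumr_const card_ord natz binS bin1 -/(deg f) => ->.
by move: mk; set S := \sum_i _; lia.
Qed.

Lemma noneff_within_le N (f : config N.+1) k l :
  k <= l -> noneff_within f k -> noneff_within f l.
Proof. by move=> kl [m mM mk]; exists m => //; apply: le_trans kl. Qed.

Lemma pos_ge0 x : 0 <= pos x. Proof. by rewrite /pos; lia. Qed.

Lemma noneff_within_lt0 N (f : config N.+1) k : k < 0 -> ~ noneff_within f k.
Proof.
move=> k0 [m _ mk]; have : 0 <= k; last by lia.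
by rewrite (le_trans _ mk) // sumr_ge0 // => i _; apply: pos_ge0.
Qed.

(** The optimal [E] for a given [m] is the positive part of [f + 1 - m]. This is the link with the
    rank, which is defined by subtracting effective configurations. *)
Lemma noneff_withinP N (f : config N.+1) k : noneff_within f k <->
  exists2 E : config N.+1, effective E & deg E <= k /\ noneff_within (f - E) 0.
Proof.
split=> [[m mM mk]|[E E0 [Ek [m mM m0]]]].
  exists [ffun i => pos (f i + 1 - m i)]; first by move=> i; rewrite ffunE pos_ge0.
  split; first by rewrite /deg; under eq_bigr do rewrite ffunE.
  exists m => //; rewrite big1 // => i _; rewrite !ffunE.
  by move: (f i) (m i) => a b; rewrite /pos; lia.
exists m => //; apply: le_trans Ek; rewrite -(lerD2r (deg E)) add0r in m0.
apply: le_trans m0; rewrite -big_split /= ler_sum // => i _.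
by have := E0 i; rewrite !ffunE; move: (f i) (E i) (m i) => a b d; rewrite /pos; lia.
Qed.

(** * The rank of a sorted parking configuration *)

Lemma card_ord_interval N i k : (k <= N.+1)%N ->
  #|[set j : 'I_N.+1 | (i <= j < k)%N]%SET| = (k - i)%N.
Proof.
move=> kN; pose h (x : 'I_(k - i)) : 'I_N.+1 := inord (i + x).
have hE x : h x = (i + x)%N :> nat by rewrite inordK //; have := ltn_ord x; lia.
have h_inj : injective h.
  by move=> x y /(congr1 val); rewrite /= !hE => /addnI /val_inj.
rewrite -[RHS](card_ord (k - i)) -(card_imset _ h_inj); apply: eq_card => j.
rewrite inE; apply/idP/imsetP => [/andP[ij jk]|[x _ ->]].
  have jx : (j - i < k - i)%N by lia.
  by exists (Ordinal jx) => //; apply: ord_inj; rewrite hE /= subnKC.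
by rewrite hE; have := ltn_ord x; lia.
Qed.

Lemma perm_equiv_tperm N (f : config N.+1) (j j' : 'I_N.+1) :
  (j < N)%N -> (j' < N)%N -> f j = f j' ->
  perm_equiv (f - unit_config j) (f - unit_config j').
Proof.
move=> jN j'N fj; apply: (@perm_equiv_perm _ (tperm j j')) => [|i].
  by rewrite tpermD // -val_eqE /= neq_ltn ?jN ?j'N.
rewrite !ffunE; case: tpermP => [->|->|/eqP/negPf -> /eqP/negPf ->] //.
  by rewrite !eqxx fj.
by rewrite fj eq_sym.
Qed.

(** Testing the parking condition on [Y = {i, ..., N - 1}] gives [f i <= i], by sortedness.
    Conversely, the least element [k] of any [Y] is a valid choice, since [#|Y| <= N - k]. *)
Lemma K_indexP N (f : config N.+1) : K_index f <->
  (forall i : 'I_N.+1, (i < N)%N -> 0 <= f i <= i%:Z) /\ sorted_off_sink f.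
Proof.
split=> -[fP fS]; split=> //.
  move=> i iN; have [f0 fY] := fP; rewrite f0 //=.
  have [||k] := fY [set j : 'I_N.+1 | (i <= j < N)%N]%SET.
  - by apply/set0Pn; exists i; rewrite inE leqnn.
  - by move=> j; rewrite inE => /andP[].
  rewrite inE card_ord_interval ?leqnSn // => /andP[ik kN] fk.
  by have := fS _ _ ik kN; lia.
split=> [i /fP/andP[]//|Y /set0Pn[y yY] YN].
have [k kY kmin] := arg_minnP (fun i : 'I_N.+1 => i : nat) yY; exists k => //.
have kN : (k < N)%N by apply: YN.
have : (#|Y| <= N - k)%N.
  rewrite -(card_ord_interval k (leqnSn N)) // subset_leq_card //.
  by apply/fintype.subsetP => i iY; rewrite inE kmin //; apply: YN.
by have /andP[_] := fP k kN; lia.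
Qed.

(* For s the value of f at the sink, the label inequality (N + 1) y - N x <= s
   amounts to y - floor ((s - y) / N) <= x.  If row y contains left cells of
   label <= s for a north step at the abscissa f y, then excess f y is their
   number; otherwise, - excess f y is the number of right cells of label > s. *)
Definition excess N (f : config N.+1) (i : 'I_N.+1) : int :=
  f i - i%:Z + ((f ord_max + N%:Z - i%:Z) %/ N%:Z)%Z.

Definition phi N (f : config N.+1) : int :=
  \sum_(i | i != ord_max) pos (excess f i).

Lemma ord_max_neq N (i : 'I_N.+1) : (i != ord_max) = (i < N)%N.
Proof. by rewrite -val_eqE /= ltn_neqAle -ltnS ltn_ord andbT. Qed.

(** * Effect on [phi] of removing a unit *)

Lemma divz_shift (d q a : int) : 0 < d -> ((a + q * d) %/ d)%Z = q + (a %/ d)%Z.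
Proof. by move=> d0; rewrite addrC divzMDl ?gt_eqF. Qed.

Lemma divz_pred (a d : int) : 0 < d ->
  (a %/ d)%Z <= ((a - 1) %/ d)%Z + ((d %| a)%Z : nat)%:Z.
Proof.
move=> d0; have [/dvdzP[q ->]|nd] := boolP (d %| a)%Z.
  by rewrite mulzK ?gt_eqF // -lerBlDr lez_divRL //; nia.
rewrite addr0 lez_divRL // {2}(divz_eq a d).
have := modz_ge0 a (lt0r_neq0 d0).
have : (a %% d)%Z != 0 by apply: contraNneq nd => /dvdz_mod0P.
lia.
Qed.

(** The floor in [excess f i] drops only if [N] divides its numerator, that is, only in the row [i0]
    congruent to [f ord_max] modulo [N], and it drops by 1. *)
Lemma phi_decr_sink N (f : config N.+1) : (0 < N)%N ->
  phi f <= phi (f - unit_config ord_max) + 1.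
Proof.
move=> N0; have [i0 i0E] : exists i0 : 'I_N.+1, i0%:Z = (f ord_max %% N%:Z)%Z.
  have N0' : N%:Z != 0 by lia.
  have h : (absz (f ord_max %% N%:Z)%Z < N.+1)%N.
    have := ltz_pmod (f ord_max) (_ : 0 < N%:Z); have := modz_ge0 (f ord_max) N0'.
    lia.
  by exists (Ordinal h); rewrite /= gez0_abs ?modz_ge0.
apply: (@sum_pos_step _ _ i0) => i; rewrite ord_max_neq => iN.
rewrite /excess !ffunE eqxx (_ : (i == ord_max) = false); last first.
  by apply/negbTE; rewrite ord_max_neq.
rewrite subr0; set a := f ord_max + N%:Z - i%:Z.
have -> : f ord_max - 1 + N%:Z - i%:Z = a - 1 by rewrite /a; ring.
have := divz_pred a (_ : 0 < N%:Z); rewrite ltz_nat => /(_ N0).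
suff : ((N%:Z %| a)%Z <= (i == i0))%N.
  move: (a %/ N%:Z)%Z ((a - 1) %/ N%:Z)%Z (f i - i%:Z) (N%:Z %| a)%Z (i == i0).
  by move=> x y z; lia.
case: (boolP (_ %| _)%Z) => //= /dvdzP[q aE].
suff -> : i = i0 by rewrite eqxx.
apply: ord_inj; apply/eqP; rewrite -eqz_nat i0E; apply/eqP.
have -> : f ord_max = i%:Z + (q - 1) * N%:Z by move: aE; rewrite /a; lia.
by rewrite addrC modzMDl modz_small //; lia.
Qed.

(** The unit is removed at the first index [k] with [f k = f j], so that the result stays sorted;
    exchanging [j] and [k] gives the equivalence. *)
Lemma decr_nonsink N (f : config N.+1) (j : 'I_N.+1) :
  K_index f -> (j < N)%N -> 0 < f j ->
  exists p : config N.+1, [/\ K_index p, perm_equiv (f - unit_config j) p &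
    phi f <= phi p + 1].
Proof.
move=> /K_indexP[fP fS] jN fj.
have [k /eqP fk kmin] := @arg_minnP _ j (fun i => f i == f j) (fun i => i) (eqxx _).
have kN : (k < N)%N by apply: leq_ltn_trans jN; apply: kmin.
have pE i : (f - unit_config k) i = f i - (i == k)%:Z by rewrite !ffunE.
exists (f - unit_config k); split; last 1 first.
- apply: (@sum_pos_step _ _ k) => i; rewrite ord_max_neq => iN.
  rewrite /excess !pE (_ : (ord_max == k) = false) ?subr0.
    by set x := divz _ _; set y := f i; lia.
  by apply/negbTE; rewrite eq_sym ord_max_neq.
- apply/K_indexP; split=> [i iN|a b ab bN]; rewrite !pE.
    by have := fP i iN; case: eqVneq => [->|_] /=; rewrite ?fk; lia.
  have := fS a b ab bN; case: (eqVneq b k) => [bk|_] /=; last by lia.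
  have [ak|ak] := eqVneq a k; first by rewrite ak bk /=; lia.
  suff : f a != f b by set x := f a; set y := f b; lia.
  apply: contraNneq ak => fab; apply/eqP/ord_inj/eqP.
  rewrite eqn_leq kmin ?andbT; last by rewrite fab bk fk.
  by rewrite -bk.
- exact: perm_equiv_tperm.
Qed.

(** [f i = i] means that the path touches the diagonal at row [i]. The sink, of index [N], stands
    for the case of no return before the end. *)
Lemma first_return N (f : config N.+1) : (0 < N)%N -> K_index f ->
  exists2 k : 'I_N.+1, (0 < k)%N & [/\ (k < N)%N -> f k = k%:Z &
    forall i : 'I_N.+1, (0 < i < k)%N -> f i < i%:Z].
Proof.
move=> N0 /K_indexP[fP _].
pose P (k : 'I_N.+1) := (0 < k)%N && (((k < N)%N) ==> (f k == k%:Z)).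
have Pmax : P ord_max by rewrite /P /= N0 ltnn.
have [k /andP[k0 /implyP kP] kmin] := @arg_minnP _ ord_max P (fun i => i) Pmax.
exists k => //; split=> [/kP/eqP//|i /andP[i0 ik]].
have iN : (i < N)%N by have := ltn_ord k; lia.
have : ~~ P i by apply: contraL ik => /kmin; rewrite -leqNgt.
by rewrite /P i0 iN /=; have := fP i iN; set x := f i; lia.
Qed.

(** For [k <= N], the rotation [i |-> i - k] modulo [N] of the non-sink indices, the sink being
    fixed. *)
Definition rot_off_sink N (k : nat) (i : 'I_N.+1) : 'I_N.+1 :=
  if (i < N)%N then inord (if (i < k)%N then i + (N - k) else i - k)%N else i.

Lemma rot_off_sinkE N k (i : 'I_N.+1) : (k <= N)%N -> rot_off_sink k i =
  (if (i < N)%N then if (i < k)%N then i + (N - k) else i - k else i)%N :> nat.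
Proof.
move=> kN; rewrite /rot_off_sink; case: ifP => // iN.
by rewrite inordK //; case: ifP => ik; lia.
Qed.

Lemma rot_off_sink_inj N k : (k <= N)%N -> injective (@rot_off_sink N k).
Proof.
move=> kN i j /(congr1 val) /=; rewrite !rot_off_sinkE // => h; apply: ord_inj.
by move: h (ltn_ord i) (ltn_ord j); do ! case: ifP => ?; lia.
Qed.

(* The vertices i >= k and the sink are fired: this is the rotation of the word
   of f at its first return to the diagonal. *)
Lemma decr_zero N (f : config N.+1) : (0 < N)%N -> K_index f ->
  exists p : config N.+1, [/\ K_index p, perm_equiv (f - unit_config ord0) p &
    phi f <= phi p + 1].
Proof.
move=> N0 fK; have [k k0 [fk fret]] := first_return N0 fK.
have [fP fS] := (K_indexP f).1 fK; have kN : (k <= N)%N by have := ltn_ord k; lia.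
(* The laplacian vectors sum to 0, so adding those of the [i < k] amounts to subtracting those of
   the other vertices. *)
pose s := perm (rot_off_sink_inj kN); pose c (i : 'I_N.+1) : int := (i < k)%N.
have sE (i : 'I_N.+1) : s i = (if (i < N)%N then
    if (i < k)%N then i + (N - k) else i - k else i)%N :> nat.
  by rewrite permE rot_off_sinkE.
have sm : s ord_max = ord_max by apply: ord_inj; rewrite sE /= ltnn.
have cE i : topple c i = (if (i < k)%N then N.+1%:Z else 0) - k%:Z.
  rewrite /topple /c; congr (_ - _); first by case: ifP => _; rewrite ?mulr1 ?mulr0.
  rewrite -(big_morph Posz PoszD (erefl _)) -big_mkcond /=.
  by rewrite -(big_ord_widen _ (fun=> 1%N)) ?sum1_card ?card_ord // ltnW.
pose p : config N.+1 :=
  [ffun x => f (s^-1%g x) - (s^-1%g x == ord0)%:Z + topple c (s^-1%g x)].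
have ps i : p (s i) = f i - (i == ord0)%:Z + topple c i by rewrite ffunE permK.
have pmax : p ord_max = f ord_max - k%:Z.
  rewrite -{1}sm ps cE (_ : (ord_max == ord0) = false).
    by rewrite [X in (X < k)%N]/= ltnNge kN subr0 sub0r.
  by rewrite -val_eqE /=; lia.
exists p; split.
- have f0 : f ord0 = 0 by have := fP ord0 N0; set x := f _; rewrite /=; lia.
  (* For [0 < i < k] the strict inequality pays for the entry gaining [N + 1 - k] while the index
     gains [N - k]; for [i >= k] the bound [k <= f i] keeps [f i - k] nonnegative. *)
  have fE (i : 'I_N.+1) : (i < N)%N -> [/\ 0 <= f i <= i%:Z,
      i = 0%N :> nat -> f i = 0, (0 < i < k)%N -> f i < i%:Z &
      (k <= i)%N -> k%:Z <= f i].
    move=> iN; split; [exact: fP | | exact: fret |].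
      by move=> i0; rewrite (_ : i = ord0) //; apply: ord_inj.
    by move=> ki; rewrite -fk ?fS //; apply: leq_ltn_trans iN.
  apply/K_indexP; split=> [x|x y].
    rewrite -[x](permKV s); move: (s^-1%g x) => {x} i; rewrite sE ps cE -val_eqE /=.
    case: ifP => [iN _|->//]; have [] := fE i iN; move: (f i) (ltn_ord i) => v.
    by case: (ltnP i k); case: eqP => /=; lia.
  rewrite -[x](permKV s) -[y](permKV s).
  move: (s^-1%g x) (s^-1%g y) => {x y} i j; rewrite !sE !ps !cE -!val_eqE /=.
  case: (ltnP j N) => [jN|]; last by lia.
  case: (ltnP i N) => [iN|]; last by have := ltn_ord k; case: ifP; lia.
  have [] := fE i iN; have [] := fE j jN; have := fS i j.
  move: (f i) (f j) => v w.
  case: (ltnP i k); case: (ltnP j k); case: (eqVneq (i : nat) 0%N);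
    by case: (eqVneq (j : nat) 0%N) => /=; lia.
- exists s, c; split=> // i; rewrite ps !ffunE //.
(* The changes of entry, index and sink compensate: [excess p (s i)] equals [excess f i], except for
   [i = 0] where it is smaller by 1. *)
- apply: (@le_trans _ _ (\sum_(i < N.+1 | i != ord_max) pos (excess p (s i)) + 1)).
    apply: (@sum_pos_step _ _ ord0) => i; rewrite ord_max_neq => iN.
    rewrite /excess pmax sE iN ps cE; case: ifP => ik.
      have -> : f ord_max - k%:Z + N%:Z - (i + (N - k))%N%:Z =
        f ord_max + N%:Z - i%:Z + (-1) * N%:Z by lia.
      rewrite divz_shift; last by lia.
      by set x := divz _ _; set y := f i; lia.
    have -> : f ord_max - k%:Z + N%:Z - (i - k)%N%:Z = f ord_max + N%:Z - i%:Z by lia.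
    by set x := divz _ _; set y := f i; lia.
  rewrite lerD2r /phi [leRHS](reindex_perm s) /=.
  rewrite [leRHS](eq_bigl (fun i => i != ord_max)) // => i.
  by rewrite -{1}sm (inj_eq perm_inj).
Qed.

(** If [f j = 0] with [j] not the sink, then [f 0 = 0] too and the unit is moved to the vertex 0,
    where [decr_zero] applies. *)
Lemma decr_unit N (f : config N.+1) j : (0 < N)%N -> K_index f ->
  exists p : config N.+1, [/\ K_index p, perm_equiv (f - unit_config j) p &
    phi f <= phi p + 1].
Proof.
move=> N0 fK; have [fP fS] := (K_indexP f).1 fK.
have [jN|] := boolP (j < N)%N; last rewrite -ord_max_neq negbK => /eqP ->.
  have [fj|fj] := ltP 0 (f j); first exact: decr_nonsink.
  have fj0 : f j = f ord0.
    have := fP j jN; have := fP ord0 N0; move: fj.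
    by set x := f j; set y := f _; rewrite /=; lia.
  have [p [pK pE pphi]] := decr_zero N0 fK; exists p; split=> //.
  by apply: perm_equiv_trans pE; apply: perm_equiv_tperm.
exists (f - unit_config ord_max); split; [|exact: perm_equiv_refl|exact: phi_decr_sink].
have pE (i : 'I_N.+1) : (i < N)%N -> (f - unit_config ord_max) i = f i.
  by rewrite -ord_max_neq !ffunE => /negPf ->; rewrite subr0.
apply/K_indexP; split=> [i iN|a b ab bN]; first by rewrite pE ?fP.
by rewrite !pE ?fS //; apply: leq_ltn_trans bN.
Qed.

Lemma deg_unit N (j : 'I_N.+1) : deg (unit_config j) = 1.
Proof.
rewrite /deg (bigD1 j) //= ffunE eqxx big1 ?addr0 // => i /negPf ij.
by rewrite ffunE ij.
Qed.

Lemma degB N (f g : config N.+1) : deg (f - g) = deg f - deg g.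
Proof. by rewrite /deg -sumrB; apply: eq_bigr => i _; rewrite !ffunE. Qed.

Lemma deg_effective_ge0 N (E : config N.+1) : effective E -> 0 <= deg E.
Proof. by move=> E0; apply: sumr_ge0. Qed.

(** Induction on [deg E], one unit at a time. The representative reached so far is permuted, so the
    next unit is removed at a transported vertex [j']. *)
Lemma decr_effective N (f E : config N.+1) : (0 < N)%N -> K_index f ->
  effective E -> exists p : config N.+1,
  [/\ K_index p, perm_equiv (f - E) p & phi f <= phi p + deg E].
Proof.
move=> N0 fK; have [d] := ubnP (absz (deg E)); elim: d E => // d IH E Ed E0.
have [[j Ej]|Enone] := pselect (exists j, 0 < E j); last first.
  have -> : E = 0.
    apply/ffunP => i; rewrite ffunE; apply/eqP; rewrite eq_le E0 andbT leNgt.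
    by apply/negP => Ei; apply: Enone; exists i.
  exists f; rewrite subr0; split=> //; first exact: perm_equiv_refl.
  by rewrite /deg big1 ?addr0 // => i _; rewrite ffunE.
have E'0 : effective (E - unit_config j).
  move=> i; rewrite !ffunE; have := E0 i.
  by case: eqVneq => [->|_] /=; rewrite ?subr0 // subr_ge0.
have := deg_effective_ge0 E'0; rewrite degB deg_unit => dE'.
have [|p [pK pE pphi]] := IH _ _ E'0; first by move: Ed; rewrite degB deg_unit; lia.
have [j' fE] := perm_equiv_sub_unit j pE.
have [q [qK qE qphi]] := decr_unit j' N0 pK; exists q; split=> //.
  apply: perm_equiv_trans qE; apply: perm_equiv_trans fE.
  by rewrite opprB addrA addrAC addrK; apply: perm_equiv_refl.
by move: pphi; rewrite degB deg_unit; lia.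
Qed.

(** Toppling at the sink [k] times makes all other entries of [h] at most 0. The result is an
    effective configuration subtracted from one that vanishes off the sink, and the latter is sorted
    parking. *)
Lemma exists_parking_rep N (h : config N.+1) : (0 < N)%N ->
  exists2 p : config N.+1, K_index p & perm_equiv h p.
Proof.
move=> N0; pose k := \sum_i `|h i|.
pose c (i : 'I_N.+1) : int := if i == ord_max then k else 0.
have cE i : topple c i = (if i == ord_max then N.+1%:Z * k else 0) - k.
  rewrite /topple /c; congr (_ - _); first by case: ifP; rewrite ?mulr0.
  by rewrite (bigD1 ord_max) //= eqxx big1 ?addr0 // => j /negPf ->.
pose h' : config N.+1 := [ffun i => h i + topple c i].
pose f : config N.+1 := [ffun i => if i == ord_max then h' i else 0].
have fK : K_index f.
  have f0 (i : 'I_N.+1) : (i < N)%N -> f i = 0.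
    by rewrite -ord_max_neq ffunE => /negPf ->.
  apply/K_indexP; split=> [i iN|i j ij jN]; first by rewrite f0.
  by rewrite !f0 //; apply: leq_ltn_trans jN.
have [i|p [pK pE _]] := @decr_effective _ f (f - h') N0 fK.
  rewrite !ffunE; case: ifP => [_|im]; first by rewrite subrr.
  rewrite cE im !sub0r oppr_ge0 subr_le0 /k (bigD1 i) //=.
  by rewrite (le_trans (ler_norm _)) // lerDl sumr_ge0.
exists p => //; apply: perm_equiv_trans pE; rewrite opprB addrC subrK.
by apply: perm_equiv_toppling; apply/toppling_equivP; exists c => i; rewrite ffunE.
Qed.

Lemma effective_noneff N (f : config N.+1) : effective f -> ~ noneff_within f 0.
Proof.
move=> f0 [m /maxnoneff_le0[i mi]]; rewrite (bigD1 i) //=.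
have := f0 i; set x := f i => x0.
suff : 0 <= \sum_(j | j != i) pos (f j + 1 - m j).
  by set S := \sum_(j | _) _; rewrite /pos; lia.
by apply: sumr_ge0 => j _; apply: pos_ge0.
Qed.

Lemma phi_sink_lt0 N (f : config N.+1) : (0 < N)%N -> K_index f ->
  f ord_max < 0 -> phi f = 0.
Proof.
move=> N0 /K_indexP[fP _] fm; apply: big1 => i; rewrite ord_max_neq => iN.
suff : ((f ord_max + N%:Z - i%:Z) %/ N%:Z)%Z < 1.
  rewrite /excess; have := fP i iN; set x := divz _ _; set y := f i; rewrite /pos; lia.
by rewrite ltz_divLR; lia.
Qed.

(** If removing [E] makes [f] non-effective, so is the sorted parking representative [p] of [f - E].
    Its sink is then negative, hence [phi p = 0] and [phi f <= deg E]. *)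
Lemma phi_le N (f : config N.+1) k : (0 < N)%N -> K_index f ->
  noneff_within f k -> phi f <= k.
Proof.
move=> N0 fK /noneff_withinP[E E0 [Ek fE]].
have [p [pK pE pphi]] := decr_effective N0 fK E0.
suff : phi p = 0 by move=> p0; apply: le_trans Ek; rewrite p0 add0r in pphi.
apply: phi_sink_lt0 => //; rewrite ltNge; apply/negP => pm.
have /effective_noneff[] : effective p; last exact: perm_equiv_noneff fE.
move=> i; have [iN|] := boolP (i < N)%N; last by rewrite -ord_max_neq negbK => /eqP ->.
by have [/(_ i iN)/andP[]] := (K_indexP p).1 pK.
Qed.

(** With [f ord_max + 1 = q N + r], the permutation gives [r] to the sink and the remaining values,
    in increasing order, to the other vertices; the sink is then toppled with coefficient [q]. *)
Lemma maxnoneff_excess N (f : config N.+1) : (0 < N)%N ->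
  maxnoneff (fun i => f i + 1 - if i == ord_max then 0 else excess f i).
Proof.
move=> N0.
pose q := ((f ord_max + 1) %/ N%:Z)%Z; pose r := absz ((f ord_max + 1) %% N%:Z)%Z.
have rE : r%:Z = ((f ord_max + 1) %% N%:Z)%Z by rewrite gez0_abs ?modz_ge0 //; lia.
have rN : (r < N)%N by have := ltz_pmod (f ord_max + 1) (_ : 0 < N%:Z); lia.
have fE : f ord_max + 1 = q * N%:Z + r%:Z by rewrite rE -divz_eq.
have rN1 : (r < N.+1)%N by apply: ltnW.
pose s : {perm 'I_N.+1} := lift_perm ord_max (Ordinal rN1) 1%g.
pose c (i : 'I_N.+1) : int := if i == ord_max then q else 0.
have cE i : topple c i = (if i == ord_max then N.+1%:Z * q else 0) - q.
  rewrite /topple /c; congr (_ - _); first by case: ifP; rewrite ?mulr0.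
  by rewrite (bigD1 ord_max) //= eqxx big1 ?addr0 // => j /negPf ->.
exists s, c => i; rewrite cE; case: (unliftP ord_max i) => [j ->|->]; last first.
  by rewrite eqxx subr0 lift_perm_id fE /=; lia.
have -> : (lift ord_max j == ord_max) = false by rewrite eq_sym (negPf (neq_lift _ _)).
rewrite lift_perm_lift perm1 /excess lift_max /= /bump.
set v := f (lift _ _).
have -> : f ord_max + N%:Z - j%:Z = (r%:Z + N%:Z - 1 - j%:Z) + q * N%:Z by lia.
rewrite divz_shift; last by lia.
suff -> : ((r%:Z + N%:Z - 1 - j%:Z) %/ N%:Z)%Z = ((j < r)%N : nat)%:Z.
  by case: (ltnP j r); case: (leqP r j); lia.
case: ltnP => jr.
  have -> : r%:Z + N%:Z - 1 - j%:Z = (r%:Z - 1 - j%:Z) + 1 * N%:Z by lia.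
  by rewrite divz_shift ?divz_small; lia.
by rewrite divz_small //; have := ltn_ord j; lia.
Qed.

Lemma noneff_within_phi N (f : config N.+1) : (0 < N)%N -> noneff_within f (phi f).
Proof.
move=> N0; eexists; first exact: maxnoneff_excess.
rewrite (bigD1 ord_max) //= eqxx subr0 subrr {1}/pos maxxx add0r.
by apply: ler_sum => i /negPf ->; rewrite subKr.
Qed.

(** The vector of [maxnoneff_excess] is in M, hence its entries have sum ['C(N.+1, 2)]. *)
Lemma sum_excess N (f : config N.+1) : (0 < N)%N ->
  \sum_(i | i != ord_max) excess f i = deg f + 1 - 'C(N, 2)%:Z.
Proof.
move=> N0; have := maxnoneff_sum (maxnoneff_excess f N0).
rewrite sumrB big_split /= sumr_const card_ord natz -/(deg f) binS bin1.
rewrite (bigD1 ord_max) //= eqxx add0r (eq_bigr (excess f)) => [|i /negPf -> //].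
by set S := \sum_(i | _) _; lia.
Qed.

(** * Riemann-Roch duality *)

(** A sorted parking representative with nonnegative sink is effective; one with negative sink has
    [phi = 0]. Hence every non-effective configuration lies below some [m - 1]. *)
Lemma LeffectiveP N (f : config N.+1) : (0 < N)%N ->
  Leffective f <-> ~ noneff_within f 0.
Proof.
move=> N0; split=> [[g g0 fg] fE|fE].
  apply: (effective_noneff g0); apply: perm_equiv_noneff fE.
  exact: perm_equiv_sym (perm_equiv_toppling fg).
have [p pK fp] := exists_parking_rep f N0.
have [pm|pm] := ltP (p ord_max) 0.
  have := noneff_within_phi p N0; rewrite phi_sink_lt0 // => pE.
  by case: fE; apply: perm_equiv_noneff pE; apply: perm_equiv_sym.
have [s [c [_ sE]]] := fp; exists [ffun i => p (s i)].
  move=> i; rewrite ffunE; move: (s i) => {}i.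
  have [iN|] := boolP (i < N)%N; last by rewrite -ord_max_neq negbK => /eqP ->.
  by have [/(_ i iN)/andP[]] := (K_indexP p).1 pK.
by apply/toppling_equivP; exists (fun i => - c i) => i; rewrite ffunE sE toppleN addrK.
Qed.

Lemma noneff_within_mono N (f g : config N.+1) k :
  (forall i, g i <= f i) -> noneff_within f k -> noneff_within g k.
Proof.
move=> gf [m mM mk]; exists m => //; apply: le_trans mk; apply: ler_sum => i _.
by have := gf i; rewrite /pos; set x := f i; set y := g i; lia.
Qed.

(** By monotonicity in [k], the two halves say that [rank f + 1] is the minimum of the positive-part
    sums. *)
Lemma rank_noneff N (f : config N.+1) : (0 < N)%N ->
  noneff_within f (rank f + 1) /\ ~ noneff_within f (rank f).
Proof.
move=> N0; have [fL|fL] := pselect (Leffective f); last first.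
  rewrite /rank asboolF //; split; last exact: noneff_within_lt0.
  by apply: contrapT => /(LeffectiveP f N0).
have [rC rmax] := rankP (ltn0Sn N) fL; split.
  apply: contrapT => fE.
  suff /rmax : rank_candidates f (rank f + 1) by lia.
  move=> lam lam0 dlam; apply/LeffectiveP => // lamE; apply: fE.
  by apply/noneff_withinP; exists lam => //; rewrite dlam.
move=> /noneff_withinP[E E0 [Er fE]].
(* [E] may have degree less than [rank f]; the missing degree is put on the vertex 0. *)
pose lam := E + [ffun i => if i == ord0 then rank f - deg E else 0].
have lamE i : E i <= lam i by rewrite /lam !ffunE lerDl; case: ifP; lia.
have /(LeffectiveP _ N0)[] : Leffective (f - lam).
  apply: rC => [i|]; first exact: le_trans (lamE i).
  rewrite /deg; under eq_bigr do rewrite !ffunE.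
  have -> : \sum_(i < N.+1) (E i + (if i == ord0 then rank f - deg E else 0)) = rank f.
    by rewrite big_split /= -big_mkcond big_pred1_eq addrC subrK.
  by [].
apply: noneff_within_mono fE => i; rewrite !ffunE lerD2l lerN2.
by have := lamE i; rewrite !ffunE.
Qed.

Lemma rank_unique N (f : config N.+1) r : (0 < N)%N ->
  noneff_within f (r + 1) -> ~ noneff_within f r -> rank f = r.
Proof.
move=> N0 fr1 fr; have [rf1 rf] := rank_noneff f N0.
have [h|h|//] := ltgtP (rank f) r; [case: fr|case: rf].
  by apply: noneff_within_le rf1; lia.
by apply: noneff_within_le fr1; lia.
Qed.

Lemma rank_phi N (f : config N.+1) : (0 < N)%N -> K_index f ->
  rank f = phi f - 1.
Proof.
move=> N0 fK; apply: rank_unique => //.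
  by rewrite subrK; apply: noneff_within_phi.
by move/(phi_le N0 fK); lia.
Qed.

Lemma rank_perm_equiv N (f g : config N.+1) : (0 < N)%N ->
  perm_equiv f g -> rank f = rank g.
Proof.
move=> N0 fg; have [g1 g0] := rank_noneff g N0; apply: rank_unique => //.
  exact: perm_equiv_noneff (perm_equiv_sym fg) g1.
by move/(perm_equiv_noneff fg).
Qed.

(** This is [2 g - 2], as [g = 'C(N, 2)] is the genus (cycle rank) of the complete graph on [N + 1]
    vertices. *)
Lemma deg_canonical_config N : deg (canonical_config N) = 'C(N, 2)%:Z * 2 - 2.
Proof.
rewrite /deg; under eq_bigr do rewrite ffunE.
rewrite sumr_const card_ord -mulr_natl natz.
by have := mul_bin_diag N 1; rewrite bin1; case: N => // N /=; nia.
Qed.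

(** [noneff_within_dual] is applied to [f] for the upper bound, and to [canonical_config N - f],
    whose dual is [f], for the lower one. *)
Lemma Riemann_Roch N (f : config N.+1) : (0 < N)%N ->
  rank (canonical_config N - f) = rank f - deg f + 'C(N, 2)%:Z - 1.
Proof.
move=> N0; have [f1 f0] := rank_noneff f N0; apply: rank_unique => //.
  by have := noneff_within_dual f1; congr noneff_within; lia.
move/noneff_within_dual; rewrite subKr degB deg_canonical_config => fE; apply: f0.
by apply: noneff_within_le fE; lia.
Qed.

(** * Uniqueness of the sorted parking representative *)

(** Otherwise the set [Y] of the minimizers of [c] avoids the sink. Each of its vertices loses at
    least [N + 1 - #|Y|], and the one given by the parking condition becomes negative. *)
Lemma parking_topple_min N (f p : config N.+1) (c : 'I_N.+1 -> int) :
  parking f -> (forall i : 'I_N.+1, (i < N)%N -> 0 <= p i) ->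
  (forall i, p i = f i + topple c i) -> forall i, c ord_max <= c i.
Proof.
move=> [_ fP] p0 pE.
have [k _ kmin] := @arg_minP _ _ _ ord_max xpredT c isT.
move=> i; apply: le_trans (kmin i isT); rewrite leNgt; apply/negP => ck.
pose Y := [set i | c i == c k]%SET.
have YN j : j \in Y -> (j < N)%N.
  by rewrite inE -ord_max_neq; apply: contraTneq => ->; rewrite gt_eqF.
have [|//|j jY] := fP Y; first by apply/set0Pn; exists k; rewrite inE.
have := p0 j (YN j jY); rewrite pE.
suff : topple c j <= #|Y|%:Z - N.+1%:Z by move: (f j) (topple c j) #|Y| => x y z; lia.
have -> : topple c j = \sum_i (c k - c i).
  move: jY; rewrite inE => /eqP <-.
  by rewrite sumrB sumr_const card_ord -[c j *+ _]mulr_natl natz.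
have -> : #|Y|%:Z - N.+1%:Z = \sum_i ((i \in Y)%:Z - 1).
  rewrite sumrB sumr_const card_ord natz -sum1_card.
  by rewrite -(big_morph Posz PoszD (erefl _)) -big_mkcond.
apply: ler_sum => a _; have := kmin a isT; rewrite inE.
by case: eqVneq => [->|/eqP] /=; lia.
Qed.

(** Both [c] and [- c] are minimal at the sink, so [c] is constant, and constants topple to 0. *)
Lemma parking_uniq N (f p : config N.+1) (c : 'I_N.+1 -> int) :
  parking f -> parking p -> (forall i, p i = f i + topple c i) -> p = f.
Proof.
move=> fP pP pE.
have c1 := parking_topple_min fP pP.1 pE.
have c2 : forall i, - c ord_max <= - c i.
  apply: (parking_topple_min pP fP.1) => i.
  by rewrite pE toppleN addrK.
have cE i : c i = c ord_max by have := c1 i; have := c2 i; lia.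
apply/ffunP => i; rewrite pE /topple (eq_bigr (fun=> c ord_max)) // cE.
by rewrite sumr_const card_ord -mulr_natl natz subrr addr0.
Qed.

(** If [g i < f i], then [s^-1] maps the [i + 1] indices [j <= i] injectively to indices less than
    [i], which is absurd. *)
Lemma sorted_perm_le N (f g : config N.+1) (s : {perm 'I_N.+1}) :
  sorted_off_sink f -> sorted_off_sink g -> s ord_max = ord_max ->
  (forall i, g (s i) = f i) -> forall i : 'I_N.+1, (i < N)%N -> f i <= g i.
Proof.
move=> fS gS sm gs i iN; rewrite leNgt; apply/negP => gf.
pose A := [set j : 'I_N.+1 | (0 <= j < i.+1)%N]%SET.
pose B := [set j : 'I_N.+1 | (0 <= j < i)%N]%SET.
have : ((s^-1)%g @: A \subset B)%SET.
  apply/fintype.subsetP => _ /imsetP[j jA ->]; move: jA; rewrite !inE /= ltnS => ji.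
  have sjN : ((s^-1)%g j < N)%N.
    rewrite -ord_max_neq; apply: contraTneq ji => sj.
    by rewrite -[j](permKV s) sj sm -ltnNge.
  rewrite ltnNge; apply: contraL gf => isj; rewrite -leNgt.
  by rewrite (le_trans (fS _ _ isj sjN)) // -gs permKV gS.
move/subset_leq_card; rewrite card_imset; last exact: perm_inj.
by rewrite !card_ord_interval; lia.
Qed.

Lemma parking_perm N (g : config N.+1) (s : {perm 'I_N.+1}) :
  s ord_max = ord_max -> parking g -> parking [ffun i => g (s i)].
Proof.
move=> sm [g0 gY]; have sN (i : 'I_N.+1) : (i < N)%N -> (s i < N)%N.
  by rewrite -!ord_max_neq -{2}sm (inj_eq perm_inj).
split=> [i iN|Y Y0 YN]; first by rewrite ffunE g0 //; apply: sN.
have [||_ /imsetP[k kY ->]] := gY (s @: Y)%SET.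
- by apply: contra_neq Y0 => /eqP; rewrite imset_eq0 => /eqP.
- by move=> _ /imsetP[i iY ->]; apply/sN/YN.
by rewrite card_imset; [exists k; rewrite ?ffunE | apply: perm_inj].
Qed.

Lemma perm_equiv_K_index N (f g : config N.+1) :
  K_index f -> K_index g -> perm_equiv f g -> f = g.
Proof.
move=> [fP fS] [gP gS] [s [c [sm fg]]].
have gs : [ffun i => g (s i)] = f.
  by apply: (parking_uniq fP (parking_perm sm gP)) => i; rewrite ffunE.
have gsE i : g (s i) = f i by rewrite -gs ffunE.
have sm' : (s^-1)%g ord_max = ord_max by rewrite -{1}sm permK.
apply/ffunP => i; have [iN|] := boolP (i < N)%N; last first.
  by rewrite -ord_max_neq negbK => /eqP ->; rewrite -gsE sm.
apply/eqP; rewrite eq_le (sorted_perm_le fS gS sm gsE) //=.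
by apply: (sorted_perm_le gS fS sm') => // j; rewrite -gsE permKV.
Qed.

(** For [0 < N] this set is a singleton, by [exists_parking_rep] and [perm_equiv_K_index], and
    [xget] returns its element. *)
Definition dual_rep N (f : config N.+1) : config N.+1 :=
  xget 0 [set p | K_index p /\ perm_equiv (canonical_config N - f) p]%classic.

Lemma dual_repP N (f : config N.+1) : (0 < N)%N ->
  K_index (dual_rep f) /\ perm_equiv (canonical_config N - f) (dual_rep f).
Proof.
move=> N0; have [p pK fp] := exists_parking_rep (canonical_config N - f) N0.
pose A := [set p | K_index p /\ perm_equiv (canonical_config N - f) p]%classic.
exact: (@xgetPex _ 0 A (ex_intro _ p (conj pK fp))).
Qed.

Lemma dual_repK N (f : config N.+1) : (0 < N)%N -> K_index f ->
  dual_rep (dual_rep f) = f.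
Proof.
move=> N0 fK; have [gK fg] := dual_repP f N0.
have [hK gh] := dual_repP (dual_rep f) N0.
apply/esym/perm_equiv_K_index => //; apply: perm_equiv_trans gh.
have [s [c [sm fgE]]] := fg; exists s, (fun i => - c i); split=> // i.
by have := fgE i; rewrite toppleN !ffunE => ->; ring.
Qed.

Lemma deg_dual_rep N (f : config N.+1) : (0 < N)%N ->
  deg (dual_rep f) = 'C(N, 2)%:Z * 2 - 2 - deg f.
Proof.
by case/(dual_repP f) => _ /perm_equiv_deg <-; rewrite degB deg_canonical_config.
Qed.

Lemma rank_dual_rep N (f : config N.+1) : (0 < N)%N ->
  rank (dual_rep f) = rank f - deg f + 'C(N, 2)%:Z - 1.
Proof.
by move=> N0; have [_ /(rank_perm_equiv N0) <-] := dual_repP f N0; rewrite Riemann_Roch.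
Qed.

(** * Paths and cells *)

(* The abscissas of the north steps of the path of w drawn from (k, 0). *)
Fixpoint abscissas (k : nat) (w : word) : seq nat :=
  match w with
  | [::] => [::]
  | true :: v => k :: abscissas k v
  | false :: v => abscissas k.+1 v
  end.

(** Inverse of [abscissas] for a path from abscissa [k] to abscissa [m]; the truncated subtractions
    are exact when [k], [l], [m] form a nondecreasing sequence. *)
Fixpoint word_of_abscissas (k m : nat) (l : seq nat) : word :=
  match l with
  | [::] => nseq (m - k) false
  | x :: l' => nseq (x - k) false ++ true :: word_of_abscissas x m l'
  end.

Lemma size_abscissas k w : size (abscissas k w) = nba w.
Proof. by rewrite /nba; elim: w k => // -[] w IH k /=; rewrite IH. Qed.

Lemma path_abscissas k w : path leq k (abscissas k w).
Proof.
elim: w k => // -[] w IH k /=; first by rewrite leqnn IH.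
by have := IH k.+1; case: abscissas => //= x l /andP[kx ->]; rewrite ltnW.
Qed.

Lemma abscissas_cat k u v :
  abscissas k (u ++ v) = abscissas k u ++ abscissas (k + nbb u) v.
Proof.
rewrite /nbb; elim: u k => [|[] u IH] k /=; first by rewrite addn0.
  by rewrite IH add0n.
by rewrite IH addnA addn1.
Qed.

Lemma abscissas_nseq k m : abscissas k (nseq m false) = [::].
Proof. by elim: m k => /=. Qed.

Lemma nbb_nseq m : nbb (nseq m false) = m.
Proof. by rewrite /nbb count_nseq mul1n. Qed.

Lemma word_of_abscissasK k m l : path leq k l ->
  abscissas k (word_of_abscissas k m l) = l.
Proof.
elim: l k => [|x l IH] k /=; first by rewrite abscissas_nseq.
move=> /andP[kx xl]; rewrite abscissas_cat abscissas_nseq nbb_nseq subnKC //=.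
by rewrite IH.
Qed.

Lemma word_of_abscissasS k m l : path leq k.+1 (rcons l m) ->
  word_of_abscissas k m l = false :: word_of_abscissas k.+1 m l.
Proof.
by case: l => [|x l] /= /andP[kx _]; rewrite subnS -[(_ - k)%N]prednK // subn_gt0.
Qed.

Lemma last_abscissas k w : (last k (abscissas k w) <= k + nbb w)%N.
Proof.
rewrite /nbb; elim: w k => [|[] w IH] k /=; first by rewrite addn0.
  by rewrite add0n IH.
rewrite addnA addn1 (leq_trans _ (IH k.+1)) //.
by have := path_abscissas k.+1 w; case: abscissas => //=.
Qed.

Lemma abscissasK k w : word_of_abscissas k (k + nbb w) (abscissas k w) = w.
Proof.
elim: w k => [|[] w IH] k /=; first by rewrite addn0 subnn.
  by rewrite subnn /= IH.
have nE : (k + nbb (false :: w) = k.+1 + nbb w)%N by rewrite /nbb /= addnA addn1.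
rewrite nE word_of_abscissasS ?IH // rcons_path path_abscissas.
exact: last_abscissas.
Qed.

Lemma nba_word_of_abscissas k m l : nba (word_of_abscissas k m l) = size l.
Proof.
rewrite /nba; elim: l k => [|x l IH] k /=; first by rewrite count_nseq.
by rewrite count_cat count_nseq /= IH.
Qed.

Lemma nbb_word_of_abscissas k m l : path leq k (rcons l m) ->
  nbb (word_of_abscissas k m l) = (m - k)%N.
Proof.
elim: l k => [|x l IH] k /=; first by rewrite nbb_nseq.
move=> /andP[kx xl]; rewrite /nbb count_cat -!/(nbb _) nbb_nseq.
rewrite [nbb (true :: _)]/= -/(nbb _) IH // add0n.
have : (x <= m)%N; last by lia.
elim: l x {kx IH} xl => [|y l IH] x /= /andP[] // xy /IH.
exact: leq_trans.
Qed.

Lemma north_stepP w x y : north_step w x y <->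
  (y < nba w)%N /\ nth 0%N (abscissas 0 w) y = x.
Proof.
rewrite -(size_abscissas 0); split=> [[u [/prefixP[v ->] ux uy]]|[yw yx]].
  rewrite cat_rcons abscissas_cat /= size_cat /= size_abscissas uy addnS.
  by rewrite ltnS leq_addr nth_cat size_abscissas uy ltnn subnn /= add0n ux.
suff h k : (y < size (abscissas k w))%N -> exists u,
    [/\ prefix (rcons u true) w, (k + nbb u)%N = nth 0%N (abscissas k w) y & nba u = y].
  by have [u [uw ux uy]] := h 0%N yw; exists u; rewrite -yx -ux.
elim: w k y {yw yx} => // -[] w IH k [|y] /=.
- by move=> _; exists [::]; rewrite /= addn0 prefix0s.
- rewrite ltnS => /IH[u [uw ux uy]]; exists (true :: u).
  by split; rewrite ?uw -?ux -?uy.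
- move=> /IH[u [uw ux uy]]; exists (false :: u).
  by split; rewrite ?uw -?ux -?uy // addSnnS.
- move=> /IH[u [uw ux uy]]; exists (false :: u).
  by split; rewrite ?uw -?ux -?uy // addSnnS.
Qed.

(** A letter b lowers [delta], so it suffices to test the prefixes followed by an a, where [delta]
    is [y] minus the abscissa of the north step. A strict prefix containing all the a's lacks at
    least one b. *)
Lemma DwordsP N w : Dwords N.+1 w <-> [/\ nba w = N, nbb w = N.+1 &
  forall y, (y < N)%N -> (nth 0 (abscissas 0 w) y <= y)%N].
Proof.
split=> -[wa wb wD]; split=> //.
  move=> y yN; have [|u [uw <- <-]] := (north_stepP w _ y).2 (conj _ (erefl _)).
    by rewrite wa.
  have [v wE] := prefixP uw; rewrite cat_rcons in wE.
  have := wD u; rewrite wE prefix_prefix /delta subr_ge0 lez_nat => /(_ isT) -> //.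
  by apply/eqP => /(congr1 size); rewrite size_cat /=; lia.
move=> u uw u_neq; have [v wE] := prefixP uw; rewrite /delta subr_ge0 lez_nat.
have v0 : (0 < size v)%N.
  by rewrite lt0n size_eq0; apply: contra_neq u_neq; rewrite wE => ->; rewrite cats0.
have sE : (nba v + nbb v)%N = size v.
  by rewrite -(count_predC (pred1 true)); congr addn; apply: eq_count => -[].
move: wa wb; rewrite wE /nba /nbb !count_cat -!/(nba _) -!/(nbb _) => wa wb.
have [uN|] := ltnP (nba u) N; last by move: wa wb sE v0; lia.
have := wD _ uN; rewrite wE abscissas_cat nth_cat size_abscissas ltnn subnn add0n.
apply: leq_trans; have := path_abscissas (nbb u) v; have := size_abscissas (nbb u) v.
by case: abscissas => [|x l] /=; [lia | move=> _ /andP[]].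
Qed.

Definition word_of_config N (f : config N.+1) : word * int :=
  (word_of_abscissas 0 N.+1 (mkseq (fun i => absz (f (inord i))) N), f ord_max).

Definition config_of_word N (ws : word * int) : config N.+1 :=
  [ffun i => if i == ord_max then ws.2 else (nth 0%N (abscissas 0 ws.1) i)%:Z].

Lemma path_config N (f : config N.+1) : K_index f ->
  path leq 0 (rcons (mkseq (fun i => absz (f (inord i))) N) N.+1).
Proof.
move=> /K_indexP[fP fS]; rewrite rcons_path; apply/andP; split.
  apply/(pathP 0%N) => -[|i]; rewrite size_mkseq => iN //=.
  rewrite !nth_mkseq //; last exact: ltnW.
  have i1 : inord i.+1 = i.+1 :> nat := inordK (ltnW iN : (i.+1 < N.+1)%N).
  have i0 : inord i = i :> nat := inordK (ltnW (ltnW iN) : (i < N.+1)%N).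
  have := fS (inord i) (inord i.+1); rewrite i0 i1 leqnSn => /(_ isT iN).
  have := fP (inord i); rewrite i0 => /(_ (ltnW iN)); move: (f _) (f _) => v w.
  lia.
have := mem_last 0%N (mkseq (fun i => absz (f (inord i))) N).
rewrite inE => /orP[/eqP -> //|/mapP[i]]; rewrite mem_iota add0n /= => iN ->.
have := fP (inord i); rewrite (inordK (ltnW iN : (i < N.+1)%N)) => /(_ iN).
by move: (f _) => v; lia.
Qed.

Lemma abscissas_config N (f : config N.+1) : K_index f ->
  abscissas 0 (word_of_config f).1 = mkseq (fun i => absz (f (inord i))) N.
Proof.
by move=> /path_config; rewrite rcons_path => /andP[fp _]; rewrite word_of_abscissasK.
Qed.

Lemma word_of_config_index N (f : config N.+1) : K_index f ->
  L_index N.+1 (word_of_config f).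
Proof.
move=> fK; apply/DwordsP; rewrite nba_word_of_abscissas size_mkseq.
rewrite nbb_word_of_abscissas ?path_config // subn0; split=> // y yN.
rewrite abscissas_config // nth_mkseq //; have [fP _] := (K_indexP f).1 fK.
have := fP (inord y); rewrite (inordK (ltnW yN : (y < N.+1)%N)) => /(_ yN).
by move: (f _) => v; lia.
Qed.

Lemma word_of_configK N (f : config N.+1) : K_index f ->
  config_of_word N (word_of_config f) = f.
Proof.
move=> fK; have [fP _] := (K_indexP f).1 fK; apply/ffunP => i; rewrite ffunE.
case: ifPn => [/eqP ->//|]; rewrite ord_max_neq => iN.
rewrite abscissas_config // nth_mkseq // inord_val gez0_abs //.
by have /andP[] := fP i iN.
Qed.

Lemma config_of_word_index N ws : L_index N.+1 ws -> K_index (config_of_word N ws).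
Proof.
move=> /DwordsP[wa wb wD].
have fE (i : 'I_N.+1) : (i < N)%N ->
    config_of_word N ws i = (nth 0%N (abscissas 0 ws.1) i)%:Z.
  by rewrite -ord_max_neq ffunE => /negPf ->.
apply/K_indexP; split=> [i iN|i j ij jN]; first by rewrite fE // lez_nat wD.
have iN := leq_ltn_trans ij jN; rewrite !fE // lez_nat.
apply: (sorted_leq_nth leq_trans leqnn) => //; rewrite ?inE ?size_abscissas ?wa //.
exact: path_sorted (path_abscissas 0 _).
Qed.

Lemma config_of_wordK N ws : L_index N.+1 ws ->
  word_of_config (config_of_word N ws) = ws.
Proof.
case: ws => w s /= /DwordsP[wa wb wD]; rewrite /word_of_config.
congr pair; last by rewrite ffunE eqxx.
rewrite -[RHS](abscissasK 0) wb; congr word_of_abscissas.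
apply: (@eq_from_nth _ 0%N); rewrite size_mkseq ?size_abscissas ?wa // => i iN.
rewrite nth_mkseq // ffunE ifN ?ord_max_neq inordK //; exact: ltnW.
Qed.

(** * Counting the cells row by row *)

Lemma card_columns N (lo hi : 'I_N -> int) (A : set (int * 'I_N)) :
  finite_set A -> (forall c, A c <-> lo c.2 <= c.1 <= hi c.2) ->
  (#|` fset_set A|%fset)%:Z = \sum_y pos (hi y - lo y + 1).
Proof.
move=> Afin AE; pose h y := absz (pos (hi y - lo y + 1)).
pose l := [seq (lo y + j%:Z, y) | y <- enum 'I_N, j <- iota 0 (h y)].
have l_uniq : uniq l.
  apply: allpairs_uniq_dep; rewrite ?enum_uniq //.
    by move=> y _; exact: iota_uniq.
  by move=> [y j] [y' j'] _ _ /= [/[swap] -> /addrI [->]].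
have -> : fset_set A = [fset x in l]%fset.
  apply/fsetP => -[x y]; rewrite in_fset_set // inE; apply/idP/allpairsPdep.
    rewrite inE => /AE /= xy; exists y, (absz (x - lo y)); rewrite mem_enum mem_iota.
    split=> //; first by rewrite /h /pos; lia.
    by congr pair; lia.
  move=> [y' [j [_ jy [-> ->]]]]; rewrite inE; apply/AE => /=.
  by move: jy; rewrite mem_iota /h /pos; lia.
rewrite card_fseq undup_id // size_allpairs_dep sumnE big_map.
rewrite big_enum /= (big_morph Posz PoszD (erefl _)).
by apply: eq_bigr => y _; rewrite size_iota /h gez0_abs ?pos_ge0.
Qed.

Lemma sum_off_sink N (F : 'I_N.+1 -> int) :
  \sum_(i | i != ord_max) F i = \sum_(y < N) F (widen_ord (leqnSn N) y).
Proof.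
rewrite big_mkcond big_ord_recr /= eqxx addr0; apply: eq_bigr => y _.
by rewrite ord_max_neq /= ltn_ord.
Qed.

(** The right-hand side is [hi - lo + 1] for the interval of abscissas of the left cells of label at
    most [s] in row [y]. *)
Lemma excess_word N w s (y : 'I_N) : (0 < N)%N ->
  excess (config_of_word N (w, s)) (widen_ord (leqnSn N) y) =
  (nth 0%N (abscissas 0 w) y)%:Z - (y%:Z - ((s - y%:Z) %/ N%:Z)%Z) + 1.
Proof.
move=> N0; rewrite /excess !ffunE eqxx ifN ?ord_max_neq //=.
have -> : s + N%:Z - y%:Z = s - y%:Z + 1 * N%:Z by ring.
by rewrite divz_shift //; ring.
Qed.

Lemma left_countE N w s : (0 < N)%N -> L_index N.+1 (w, s) ->
  (left_count N.+1 w s)%:Z = phi (config_of_word N (w, s)).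
Proof.
move=> N0 /DwordsP[wa _ _].
rewrite /left_count (@card_columns N (fun y => y%:Z - ((s - y%:Z) %/ N%:Z)%Z)
  (fun y => (nth 0%N (abscissas 0 w) y)%:Z)).
- by rewrite /phi sum_off_sink; apply: eq_bigr => y _; rewrite excess_word.
- exact: (@finite_left_cells N.+1 w s N0).
move=> [x y] /=; rewrite lerBlDr -lerBlDl lez_divRL //.
rewrite /left_cells /left_region /label /=; split.
  by move=> [[z /north_stepP[_ ->] ->]]; lia.
move=> /andP[xy xz]; split; last by lia.
by exists (nth 0%N (abscissas 0 w) y) => //; apply/north_stepP; rewrite wa.
Qed.

(** In each row the right cells of label greater than [s] fill an interval of signed length
    [- excess], and [sum_excess] relates negative parts to positive ones. *)
Lemma right_countE N w s : (0 < N)%N -> L_index N.+1 (w, s) ->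
  (right_count N.+1 w s)%:Z = phi (config_of_word N (w, s))
    - deg (config_of_word N (w, s)) + 'C(N, 2)%:Z - 1.
Proof.
move=> N0 ws; have [wa _ _] := (DwordsP N w).1 ws.
set f := config_of_word _ _.
have -> : phi f - deg f + 'C(N, 2)%:Z - 1 =
    \sum_(i | i != ord_max) pos (- excess f i).
  have -> : phi f - deg f + 'C(N, 2)%:Z - 1 =
    phi f - \sum_(i | i != ord_max) excess f i by rewrite sum_excess //; ring.
  by rewrite -sumrB; apply: eq_bigr => i _; rewrite /pos; lia.
rewrite /right_count (@card_columns N (fun y => (nth 0%N (abscissas 0 w) y)%:Z + 1)
  (fun y => y%:Z - ((s - y%:Z) %/ N%:Z)%Z - 1)).
- rewrite sum_off_sink; apply: eq_bigr => y _; rewrite excess_word //.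
  by congr pos; ring.
- exact: (@finite_right_cells N.+1 w s N0).
move=> [x y] /=.
have -> : (x <= y%:Z - ((s - y%:Z) %/ N%:Z)%Z - 1) =
    ~~ (y%:Z - x <= ((s - y%:Z) %/ N%:Z)%Z).
  by set d := divz _ _; lia.
rewrite lez_divRL // /right_cells /right_region /label /=; split.
  by move=> [[z /north_stepP[_ ->]]]; lia.
move=> /andP[xy xz]; split; last by lia.
exists (nth 0%N (abscissas 0 w) y); last by lia.
by apply/north_stepP; rewrite wa.
Qed.

(** * The bijection between the two index sets *)

Definition dual_word N (f : config N.+1) : word * int :=
  word_of_config (dual_rep f).

Lemma dual_word_index N (f : config N.+1) : (0 < N)%N ->
  L_index N.+1 (dual_word f).
Proof. by move=> N0; apply: word_of_config_index; case: (dual_repP f N0). Qed.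

(** For [g = dual_rep f], the left count is [phi g = rank g + 1], evaluated by Riemann-Roch; in the
    right count, [deg g] cancels [deg f] and only [rank f + 1] remains. *)
Lemma L_term_dual_word N (f : config N.+1) : (0 < N)%N ->
  L_term N.+1 (dual_word f) = (rank f - deg f + 'C(N, 2)%:Z, rank f + 1).
Proof.
move=> N0; have [gK _] := dual_repP f N0; have := dual_word_index f N0.
rewrite /L_term; case wE : (dual_word f) => [w s] ws /=.
rewrite right_countE // left_countE // -wE /dual_word word_of_configK //.
have := rank_phi N0 gK; rewrite rank_dual_rep // deg_dual_rep // => h.
by congr pair; lia.
Qed.

Lemma dual_wordK N (f : config N.+1) : (0 < N)%N -> K_index f ->
  dual_rep (config_of_word N (dual_word f)) = f.
Proof.
by move=> N0 fK; rewrite word_of_configK ?dual_repK //; case: (dual_repP f N0).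
Qed.

(** The pair of exponents on the right is obtained by solving [L_term_dual_word] for degree and
    rank; a preimage of [ws] is [dual_rep (config_of_word N ws)]. *)
Lemma L_fiber_image N (m : monomial) : (0 < N)%N ->
  fiber (L_index N.+1) (L_term N.+1) m =
  (@dual_word N @` fiber (@K_index N.+1) (@K_term N.+1)
    (m.2 - m.1 + 'C(N, 2)%:Z - 1, m.2 - 1))%classic.
Proof.
case: m => p q N0; apply/seteqP; split=> [ws /= [wsL wsE]|_ [f [fK fE] <-]].
  have gK := config_of_word_index wsL.
  have wsK : dual_word (dual_rep (config_of_word N ws)) = ws.
    by rewrite /dual_word dual_repK // config_of_wordK.
  have [fK _] := dual_repP (config_of_word N ws) N0.
  exists (dual_rep (config_of_word N ws)) => //; split => //.
  by move: wsE; rewrite -{1}wsK L_term_dual_word // => -[<- <-]; congr pair; ring.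
split; first exact: dual_word_index.
by move: fE; rewrite L_term_dual_word // => -[-> ->]; congr pair => /=; ring.
Qed.

(** The entries off the sink lie between 0 and [N], and the degree then determines the sink. *)
Lemma summable_K N : summable (@K_index N.+1) (@K_term N.+1).
Proof.
move=> [d r]; pose h (g : {ffun 'I_N.+1 -> 'I_N.+1}) : config N.+1 :=
  [ffun i => if i == ord_max then d - \sum_(j | j != ord_max) (g j : nat)%:Z
             else (g i : nat)%:Z].
apply: (@sub_finite_set _ _ (h @` setT)%classic); last first.
  by apply: finite_image; apply: finite_finset.
move=> f [/K_indexP[fP _] [fd _]]; exists [ffun i => inord (absz (f i))] => //.
have fE (i : 'I_N.+1) : i != ord_max -> (inord (absz (f i)) : 'I_N.+1)%:Z = f i.
  rewrite ord_max_neq => iN; have := fP i iN; move: (f i) => v vi.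
  by rewrite inordK; lia.
apply/ffunP => i; rewrite !ffunE; case: eqVneq => [->|/fE//].
rewrite (eq_bigr f) => [|j /fE jE]; last by rewrite ffunE.
by rewrite -fd /deg (bigD1 ord_max) //= addrK.
Qed.

(* The pairs are exponents of (d, r): 1/d is (-1, 0), rd is (1, 1). *)
Theorem corollary9 (n : nat) (hn : (2 <= n)%N) :
  [/\ summable (@K_index n) (@K_term n),
      summable (L_index n) (L_term n) &
      K_series n = monomial_mul ('C(n.-1, 2)%:Z - 1, -1)
              (monomial_subst (L_series n) (-1, 0) (1, 1))].
Proof.
case: n hn => // N; rewrite ltnS => N0.
have Kfin := @summable_K N; split=> // [m|].
  by rewrite L_fiber_image //; apply: finite_image.
apply/funext => -[d r]; rewrite /monomial_mul monomial_substE /L_series /K_series.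
rewrite /formal_sum L_fiber_image //= fset_set_image; last exact: Kfin.
(* [dual_word] is injective on the fiber, having a left inverse by [dual_wordK]; it remains to check
   that the exponents reduce to [(d, r)]. *)
rewrite card_in_imfset /=; last first.
  move=> f g; rewrite !in_fset_set; try exact: Kfin.
  rewrite !inE => -[fK _] [gK _] fg.
  by rewrite -(dual_wordK N0 fK) fg dual_wordK.
congr (#|` fset_set (fiber _ _ _)|%fset)%:Z.
by congr pair; ring.
Qed.
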